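(* Assume that for the scale Hilbert space $\mathcal{H}=\{(H_k,\langle\cdot,\cdot\rangle_k)\}_{k\in\mathbb{N}_0}$ a scale Hessian operator exists. Then $\mathcal{H}$ is fractal, i.e. there exists an unbounded monotone function $f\colon\mathbb{N}\to(0,\infty)$ such that $\mathcal{H}$ is scale isomorphic to $\ell^{2,f}$.
   Context: Notation: $\mathbb{N}=\{1,2,3,\dots\}$ and $\mathbb{N}_0=\{0,1,2,\dots\}$. All Hilbert spaces are real. A scale Hilbert space is a tuple $\mathcal{H}=\{(H_k,\langle\cdot,\cdot\rangle_k)\}_{k\in\mathbb{N}_0}$ where each $(H_k,\langle\cdot,\cdot\rangle_k)$ is a real Hilbert space, the vector spaces form a nested sequence $H_0\supset H_1\supset H_2\supset\cdots$, and: (i) for each $k\in\mathbb{N}$ the inclusion $(H_k,\langle\cdot,\cdot\rangle_k)\hookrightarrow(H_{k-1},\langle\cdot,\cdot\rangle_{k-1})$ is compact; (ii) for each $k\in\mathbb{N}_0$ the subspace $H_\infty=\bigcap_{n\ge 0}H_n$ is dense in $H_k$ with respect to the topology induced by $\langle\cdot,\cdot\rangle_k$. For $m\in\mathbb{N}_0$ the shifted scale Hilbert space is $\mathcal{H}^m=\{H_{k+m}\}_{k\in\mathbb{N}_0}$ (with the corresponding inner products). A map $g\colon H_0\to H_0'$ between scale Hilbert spaces $\mathcal{H},\mathcal{H}'$ is scale continuous if for each $k\in\mathbb{N}_0$ it restricts to a continuous map $H_k\to H_k'$. A scale isomorphism is a linear scale continuous map $\Phi$ such that for each $k$ the restriction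 $\Phi_k\colon H_k\to H_k'$ is a bijection; $\mathcal{H}$ and $\mathcal{H}'$ are scale isomorphic if a scale isomorphism between them exists. For a monotone unbounded function $f\colon\mathbb{N}\to(0,\infty)$, let $\ell^2_f$ be the Hilbert space of real sequences $x=(x_1,x_2,\dots)$ with $\sum_{\nu}f(\nu)x_\nu^2<\infty$ and inner product $\langle x,y\rangle_f=\sum_\nu f(\nu)x_\nu y_\nu$. The scale Hilbert space $\ell^{2,f}$ is given by $\ell^{2,f}_k=\ell^2_{f^k}$ for $k\in\mathbb{N}_0$, where $f^k(\nu)=f(\nu)^k$ (so $\ell^{2,f}_0=\ell^2$). For a vector space $H_1$ and a Hilbert space $H_0$, a linear operator $A\colon H_1\to H_0$ is Fredholm if $\ker A$ is finite dimensional, $\mathrm{im}\,A$ is a closed subspace of $H_0$, and the orthogonal complement $(\mathrm{im}\,A)^\perp\subset H_0$ is finite dimensional; its index is $\dim\ker A-\dim(\mathrm{im}\,A)^\perp$. A scale Hessian operator for $\mathcal{H}$ is a linear scale continuous operator $A\colon\mathcal{H}^1\to\mathcal{H}^0$ (i.e. a linear map $A\colon H_1\to H_0$ restricting to a continuous map $H_{k+1}\to H_k$ for each $k\in\mathbb{N}_0$) such that: (Symmetry) $\langle\xi,A\eta\rangle_0=\langle A\xi,\eta\rangle_0$ for all $\xi,\eta\in H_1$; (Fredholm) $A\colon H_1\to H_0$ is a Fredholm operator of index $0$; (Regularity) if $\xi\in H_1$ and $A\xi\in H_n$ for $n\in\mathbb{N}_0$, then $\xi\in H_{n+1}$.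
   Formalization: The formal theorem additionally assumes that H_0 is infinite dimensional; without this the claim fails, e.g. for H_k = R^n for all k with A = 0, which is a scale Hessian operator although R^n is not isomorphic to ℓ^2. *)

(* Defs.v *)
From HB Require Import structures.
From mathcomp Require Import all_boot all_order all_algebra.
From mathcomp Require Import all_classical all_reals.
From mathcomp Require Import topology normedtype sequences.
From mathcomp Require Import ring lra.

Set Implicit Arguments.
Unset Strict Implicit.
Unset Printing Implicit Defensive.

Import Order.TTheory GRing.Theory Num.Theory.
Import numFieldNormedType.Exports.

Local Open Scope classical_set_scope.
Local Open Scope ring_scope.

HB.mixin Record NormedModule_hasInner (R : realType) V
    & NormedModule R V := {
  inner : V -> V -> R;
  innerC : forall x y, inner x y = inner y x;
  innerDl : forall x y z, inner (x + y) z = inner x z + inner y z;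
  innerZl : forall (a : R) x y, inner (a *: x) y = a * inner x y;
  inner_norm : forall x, inner x x = `|x| ^+ 2
}.

#[short(type="hilbertType")]
HB.structure Definition Hilbert (R : realType) :=
  {V of CompleteNormedModule R V & NormedModule_hasInner R V}.

Arguments inner {R V} : rename.

Section operators.
Context {R : realType}.

Definition compact_operator (E F : normedModType R) (T : E -> F) :=
  forall B, bounded_set B -> precompact (T @` B).

Definition has_dim (V : lmodType R) (S : set V) (n : nat) :=
  exists e : 'I_n -> V,
    (forall c : 'I_n -> R, \sum_i c i *: e i = 0 -> forall i, c i = 0) /\
    S = range (fun c : 'I_n -> R => \sum_i c i *: e i).

Definition finite_dimensional (V : lmodType R) (S : set V) :=
  exists n, has_dim S n.

(* Only meaningful for finite-dimensional subspaces. *)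
Definition dimension (V : lmodType R) (S : set V) : nat := xget 0%N (has_dim S).

Definition orthogonal_complement (H : hilbertType R) (S : set H) : set H :=
  [set y | forall x, S x -> inner x y = 0].

Definition ker (V W : lmodType R) (A : V -> W) : set V := [set x | A x = 0].

Definition fredholm (V : lmodType R) (H : hilbertType R) (A : {linear V -> H}) :=
  [/\ finite_dimensional (ker A), closed (range A)
    & finite_dimensional (orthogonal_complement (range A))].

Definition fredholm_index (V : lmodType R) (H : hilbertType R)
    (A : {linear V -> H}) : int :=
  (dimension (ker A))%:Z -
  (dimension (orthogonal_complement (range A)))%:Z.

End operators.

(* The nested spaces H_0 >= H_1 >= ... are given as types related by injective
   linear inclusion maps H_(k+1) -> H_k. Composing the inclusions embeds H_k
   into H_0, and the image of this embedding is H_k seen as a subspace of H_0. *)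
Section tower.
Context {R : realType} (H : nat -> hilbertType R)
  (inc : forall k, {linear H k.+1 -> H k}).

Fixpoint tower_emb (k : nat) : H k -> H 0%N :=
  if k is k'.+1 then fun x => tower_emb (inc k' x) else id.

Definition tower_level (k : nat) : set (H 0%N) := range (tower_emb (k := k)).

Definition tower_infty : set (H 0%N) := \bigcap_n tower_level n.

End tower.

Record scaleHilbert (R : realType) := ScaleHilbert {
  space :> nat -> hilbertType R;
  incl : forall k, {linear space k.+1 -> space k};
  incl_inj : forall k, injective (incl k);
  incl_compact : forall k, compact_operator (incl k);
  infty_dense : forall k,
    dense (tower_emb incl (k := k) @^-1` tower_infty incl)
}.

Section scale.
Context {R : realType}.
Implicit Types H K : scaleHilbert R.

Definition emb H (k : nat) : H k -> H 0%N := @tower_emb R H (@incl R H) k.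

Definition level H (k : nat) : set (H 0%N) := range (@emb H k).
Arguments level H k : clear implicits.

(* [gk] is the restriction of [g] to the k-th levels; in particular [g] maps
   level k of [H] to level k of [K]. *)
Definition restriction H K (g : H 0%N -> K 0%N) (k : nat) (gk : H k -> K k) :=
  forall x, emb (gk x) = g (emb x).

Definition scale_continuous H K (g : H 0%N -> K 0%N) :=
  forall k, exists2 gk : H k -> K k, restriction g gk & continuous gk.

Definition scale_isomorphism H K (Phi : {linear H 0%N -> K 0%N}) :=
  scale_continuous Phi /\
  forall k, set_bij (level H k) (level K k) Phi.

Definition scale_isomorphic H K :=
  exists Phi : {linear H 0%N -> K 0%N}, scale_isomorphism Phi.

Section shift.
Variables (m : nat) (H : scaleHilbert R).

Let spaceS k : hilbertType R := H (k + m)%N.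
Let inclS k : {linear spaceS k.+1 -> spaceS k} := incl H (k + m)%N.

Lemma emb_inj k : injective (@emb H k).
Proof. by elim: k => [//|k IH] x y /IH/incl_inj. Qed.

Let shift_embE k (x : spaceS k) :
  emb (tower_emb inclS x : H m) = emb (x : H (k + m)%N).
Proof. by elim: k x => [//|k IH] x /=; rewrite IH. Qed.

Let level_decr i j (x : H 0%N) : level H (i + j)%N x -> level H j x.
Proof.
elim: i x => [//|i IH] _ [y _ <-]; apply: IH.
by exists (incl H (i + j)%N y).
Qed.

Lemma shift_dense k : dense (tower_emb inclS (k := k) @^-1` tower_infty inclS).
Proof.
suff -> : tower_emb inclS (k := k) @^-1` tower_infty inclS =
          (@emb H (k + m)%N) @^-1` tower_infty (@incl R H)
  by exact: infty_dense.
apply/seteqP; split => x /= xinf n _.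
  have [y _ yx] := xinf n Logic.I.
  apply: (@level_decr m); rewrite addnC.
  by exists y => //; rewrite -[LHS]shift_embE yx shift_embE.
have [y _ yx] := xinf (n + m)%N Logic.I.
exists y => //; apply: (@emb_inj m).
by rewrite (shift_embE y) (shift_embE x).
Qed.

Definition shift_scale : scaleHilbert R :=
  @ScaleHilbert R spaceS inclS (fun k => @incl_inj R H (k + m)%N)
    (fun k => @incl_compact R H (k + m)%N) shift_dense.

End shift.

(* The space [shift_scale 1 H 0%N] is convertible to [H 1%N]. *)
Record scale_hessian H (A : {linear shift_scale 1 H 0%N -> H 0%N}) : Prop :=
  ScaleHessian {
  hessian_continuous : @scale_continuous (shift_scale 1 H) H A;
  hessian_symmetric : forall xi eta : H 1%N,
    inner (incl H 0%N xi) (A eta) = inner (A xi) (incl H 0%N eta);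
  hessian_fredholm : fredholm A;
  hessian_index : fredholm_index A = 0;
  hessian_regular : forall (n : nat) (xi : H 1%N),
    level H n (A xi) -> level H n.+1 (incl H 0%N xi)
}.

End scale.

(* Sequences indexed by {1, 2, 3, ...} are encoded as functions on nat, the value
   at n being the (n+1)-th term. *)
Record weight (R : realType) := Weight {
  weight_fun :> nat -> R;
  weight_gt0 : forall n, 0 < weight_fun n
}.

Section weighted_sums.
Context {R : realType} (w : weight R).
Implicit Types x y : nat -> R.

Definition square_summable : {pred nat -> R} :=
  fun x => `[< cvgn (series (fun n => w n * x n ^+ 2)) >].

Lemma sq_ge0 x n : 0 <= w n * x n ^+ 2.
Proof. by rewrite mulr_ge0 ?sqr_ge0// ltW// weight_gt0. Qed.

Lemma sq_series_nd x : nondecreasing_seq (series (fun n => w n * x n ^+ 2)).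
Proof. by apply: nondecreasing_series => n _ _; exact: sq_ge0. Qed.

Lemma square_summable_bound x M :
  (forall N, series (fun n => w n * x n ^+ 2) N <= M) ->
  x \in square_summable /\ limn (series (fun n => w n * x n ^+ 2)) <= M.
Proof.
move=> xM.
have c : cvgn (series (fun n => w n * x n ^+ 2)).
  apply: nondecreasing_is_cvgn; first exact: sq_series_nd.
  by exists M => _ [n _ <-].
by split; [exact/asboolP|apply: limr_le => //; exact: nearW].
Qed.

Lemma square_summable_le x : x \in square_summable -> forall N,
  series (fun n => w n * x n ^+ 2) N <=
  limn (series (fun n => w n * x n ^+ 2)).
Proof.
by move=> /asboolP cx; apply: nondecreasing_cvgn_le => //; exact: sq_series_nd.
Qed.

Lemma is_cvg_seriesM x y : x \in square_summable -> y \in square_summable ->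
  cvgn (series (fun n => w n * x n * y n)).
Proof.
move=> /asboolP cx /asboolP cy; apply: normed_cvg.
apply: (@series_le_cvg _ _
  ((fun n => w n * x n ^+ 2) + (fun n => w n * y n ^+ 2))) => [n|n|n|].
- exact: normr_ge0.
- by rewrite addr_ge0// sq_ge0.
- rewrite /= !normrM gtr0_norm ?weight_gt0// -mulrA -[leRHS]mulrDr.
  rewrite ler_wpM2l ?(ltW (weight_gt0 _ _))// -(real_normK (num_real (x n))).
  rewrite -(real_normK (num_real (y n))).
  by have := normr_ge0 (x n); have := normr_ge0 (y n); nra.
- exact: is_cvg_seriesD.
Qed.

Lemma square_summable_submod : subsemimod_closed square_summable.
Proof.
split; first split.
- apply: (square_summable_bound (M := 0) _).1 => N.
  by rewrite /series/= big1// => i _; rewrite expr0n mulr0.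
- move=> x y hx hy; apply/asboolP.
  have -> : (fun n => w n * (x + y) n ^+ 2) =
      (fun n => w n * x n ^+ 2) + (2 *: (fun n => w n * x n * y n)) +
      (fun n => w n * y n ^+ 2).
    apply/funext => n; rewrite -[(x + y) n]/(x n + y n).
    rewrite -[RHS]/(w n * x n ^+ 2 + 2 * (w n * x n * y n) + w n * y n ^+ 2).
    ring.
  apply: is_cvg_seriesD; last exact/asboolP.
  apply: is_cvg_seriesD; first exact/asboolP.
  exact/is_cvg_seriesZ/is_cvg_seriesM.
- move=> a x /asboolP cx; apply/asboolP.
  have -> : (fun n => w n * (a *: x) n ^+ 2) =
      a ^+ 2 *: (fun n => w n * x n ^+ 2).
    apply/funext => n; rewrite -[(a *: x) n]/(a * x n).
    rewrite -[RHS]/(a ^+ 2 * (w n * x n ^+ 2)); ring.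
  exact: is_cvg_seriesZ.
Qed.

HB.instance Definition _ :=
  GRing.isSubmodClosed.Build R (nat -> R) square_summable square_summable_submod.

Record l2 := L2 { l2_seq :> nat -> R; l2_summable : l2_seq \in square_summable }.

HB.instance Definition _ := [isSub for l2_seq].
HB.instance Definition _ := [Choice of l2 by <:].
HB.instance Definition _ := [SubChoice_isSubLmodule of l2 by <:].

End weighted_sums.

Section l2_hilbert.
Context {R : realType} (w : weight R).
Implicit Types x y z : l2 w.

Definition l2_inner x y : R := limn (series (fun n => w n * x n * y n)).

Lemma l2D x y n : (x + y) n = x n + y n. Proof. by []. Qed.
Lemma l2Z a x n : (a *: x) n = a * x n. Proof. by []. Qed.
Lemma l2B x y n : (x - y) n = x n - y n. Proof. by []. Qed.

Lemma l2_innerC x y : l2_inner x y = l2_inner y x.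
Proof.
by congr (limn (series _)); apply/funext => n; rewrite mulrAC.
Qed.

Let cvgM x y : cvgn (series (fun n => w n * x n * y n)).
Proof. by apply: is_cvg_seriesM; exact: l2_summable. Qed.

Lemma l2_innerDl x y z : l2_inner (x + y) z = l2_inner x z + l2_inner y z.
Proof.
rewrite /l2_inner -lim_seriesD//; congr (limn (series _)).
by apply/funext => n; rewrite l2D mulrDr mulrDl.
Qed.

Lemma l2_innerZl a x y : l2_inner (a *: x) y = a * l2_inner x y.
Proof.
rewrite /l2_inner -[RHS]lim_seriesZ//; congr (limn (series _)).
apply/funext => n; rewrite l2Z -[RHS]/(a * (w n * x n * y n)); ring.
Qed.

Lemma l2_inner_sq x : l2_inner x x = limn (series (fun n => w n * x n ^+ 2)).
Proof. by congr (limn (series _)); apply/funext => n; rewrite expr2 mulrA. Qed.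

Lemma l2_inner_ge x N : series (fun n => w n * x n ^+ 2) N <= l2_inner x x.
Proof. by rewrite l2_inner_sq square_summable_le// l2_summable. Qed.

Lemma l2_inner_ge0 x : 0 <= l2_inner x x.
Proof. by apply: le_trans (l2_inner_ge x 0); rewrite /series/= big_geq. Qed.

Lemma l2_coord_le x n : w n * x n ^+ 2 <= l2_inner x x.
Proof.
apply: le_trans (l2_inner_ge x n.+1).
rewrite /series/= big_nat_recr//= lerDr.
by apply: sumr_ge0 => i _; exact: sq_ge0.
Qed.

Lemma l2_inner_eq0 x : l2_inner x x = 0 -> x = 0.
Proof.
move=> x0; apply: val_inj; apply/funext => n /=.
have := l2_coord_le x n; rewrite x0 => h.
have /eqP : w n * x n ^+ 2 = 0 by apply/eqP; rewrite eq_le h sq_ge0.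
by rewrite mulf_eq0 gt_eqF ?weight_gt0//= sqrf_eq0 => /eqP.
Qed.

Definition l2_norm x : R := Num.sqrt (l2_inner x x).

Lemma l2_norm_sq x : l2_norm x ^+ 2 = l2_inner x x.
Proof. by rewrite sqr_sqrtr// l2_inner_ge0. Qed.

Lemma l2_norm_ge0 x : 0 <= l2_norm x. Proof. exact: sqrtr_ge0. Qed.

Lemma l2_norm_eq0 x : l2_norm x = 0 -> x = 0.
Proof. by move=> x0; apply: l2_inner_eq0; rewrite -l2_norm_sq x0 expr0n. Qed.

Lemma l2_innerZr a x y : l2_inner x (a *: y) = a * l2_inner x y.
Proof. by rewrite l2_innerC l2_innerZl l2_innerC. Qed.

Lemma l2_innerDr x y z : l2_inner x (y + z) = l2_inner x y + l2_inner x z.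
Proof. by rewrite l2_innerC l2_innerDl !(l2_innerC x). Qed.

Lemma l2_cauchy_schwarz x y : l2_inner x y <= l2_norm x * l2_norm y.
Proof.
have [x0|xN0] := eqVneq (l2_norm x) 0.
  by rewrite (l2_norm_eq0 x0) -(scale0r 0) l2_innerZl mul0r mulr_ge0// l2_norm_ge0.
have [y0|yN0] := eqVneq (l2_norm y) 0.
  by rewrite (l2_norm_eq0 y0) -(scale0r 0) l2_innerZr mul0r mulr_ge0// l2_norm_ge0.
have x0 : 0 < l2_norm x by rewrite lt_def xN0 l2_norm_ge0.
have y0 : 0 < l2_norm y by rewrite lt_def yN0 l2_norm_ge0.
have := l2_inner_ge0 (l2_norm y *: x + (- l2_norm x) *: y).
rewrite l2_innerDl !l2_innerDr !l2_innerZl !l2_innerZr (l2_innerC y x).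
rewrite -!l2_norm_sq => h.
rewrite -(ler_pM2l (mulr_gt0 x0 y0)); nra.
Qed.

Lemma l2_normD x y : l2_norm (x + y) <= l2_norm x + l2_norm y.
Proof.
rewrite -(@ler_pXn2r _ 2)// ?nnegrE ?addr_ge0 ?l2_norm_ge0//.
rewrite l2_norm_sq l2_innerDl !l2_innerDr (l2_innerC y x) -!l2_norm_sq.
by have := l2_cauchy_schwarz x y; nra.
Qed.

Lemma l2_normZ a x : l2_norm (a *: x) = `|a| * l2_norm x.
Proof.
rewrite /l2_norm l2_innerZl l2_innerZr mulrA -expr2 sqrtrM ?sqr_ge0//.
by rewrite sqrtr_sqr.
Qed.

HB.instance Definition _ := Lmodule_isNormed.Build R (l2 w)
  l2_normD l2_normZ l2_norm_eq0.

Lemma l2_normE x : `|x| ^+ 2 = l2_inner x x. Proof. exact: l2_norm_sq. Qed.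

Lemma l2_norm_le x M : 0 <= M ->
  (forall N, series (fun n => w n * x n ^+ 2) N <= M ^+ 2) -> `|x| <= M.
Proof.
move=> M0 /square_summable_bound[_].
by rewrite -l2_inner_sq -l2_normE ler_pXn2r// nnegrE.
Qed.

Lemma l2_coord_norm x n : `|x n| <= (Num.sqrt (w n))^-1 * `|x|.
Proof.
have sw : 0 < Num.sqrt (w n) by rewrite sqrtr_gt0 weight_gt0.
rewrite -ler_pdivrMl ?invr_gt0// invrK.
rewrite -(@ler_pXn2r _ 2)// ?nnegrE ?mulr_ge0// ?(ltW sw)//.
rewrite exprMn sqr_sqrtr ?(ltW (weight_gt0 _ _))// real_normK ?num_real//.
by rewrite l2_normE; exact: l2_coord_le.
Qed.

End l2_hilbert.

Section coordinatewise_limits.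
Context {R : realType} (w : nat -> R) (T : Type) (F : set_system T)
  {FF : ProperFilter F} (c : T -> nat -> R) (a b : nat -> R).
Hypothesis ca : forall n, (fun t => c t n) @ F --> a n.

Lemma cvg_sq_series N :
  (fun t => series (fun n => w n * (b n - c t n) ^+ 2) N) @ F -->
  series (fun n => w n * (b n - a n) ^+ 2) N.
Proof.
elim: N => [|N IH].
  rewrite /series/= big_geq//; under eq_cvg do rewrite big_geq//.
  exact: cvg_cst.
rewrite seriesSr; under eq_cvg do rewrite seriesSr.
apply: cvgD => //; apply: cvgMr; rewrite expr2; under eq_cvg do rewrite expr2.
by apply: cvgM; apply: cvgB => //; exact: cvg_cst.
Qed.

Lemma sq_series_lim_le M N :
  (\forall t \near F, series (fun n => w n * (b n - c t n) ^+ 2) N <= M) ->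
  series (fun n => w n * (b n - a n) ^+ 2) N <= M.
Proof. exact: cvgr_to_le (cvg_sq_series (N := N)). Qed.

End coordinatewise_limits.

Section l2_complete.
Context {R : realType} (w : weight R).

Lemma l2_complete (F : set_system (l2 w)) :
  ProperFilter F -> cauchy F -> cvg F.
Proof.
move=> FF Fc.
have coordc n : cvg ((fun x : l2 w => x n) @ F).
  apply: cauchy_cvg; apply/cauchyP => e e0.
  have sw : 0 < Num.sqrt (w n) by rewrite sqrtr_gt0 weight_gt0.
  have [x Fx] := (cauchyP F).1 Fc _ (mulr_gt0 sw e0).
  exists (x n); change (F ((fun y : l2 w => y n) @^-1` ball (x n) e)).
  apply: filterS Fx => y /=; rewrite -!ball_normE/= => xy.
  apply: le_lt_trans (l2_coord_norm (x - y) n) _.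
  by rewrite ltr_pdivrMl.
pose a n := lim ((fun x : l2 w => x n) @ F).
have ca n : (fun x : l2 w => x n) @ F --> a n by exact: coordc.
have dist_le (x : l2 w) e : F (ball x e) -> 0 < e -> forall N,
    series (fun n => w n * (x n - a n) ^+ 2) N <= e ^+ 2.
  move=> Fx e0 N; apply: (sq_series_lim_le ca); apply: filterS Fx => y.
  rewrite -ball_normE/= => xy; apply: le_trans (l2_inner_ge (x - y) N) _.
  by rewrite -l2_normE ler_pXn2r ?nnegrE// ltW.
have [x0 Fx0] := (cauchyP F).1 Fc _ ltr01.
have [xa _] := square_summable_bound (dist_le _ _ Fx0 ltr01).
pose l : l2 w := x0 - L2 xa.
have la n : l n = a n by rewrite l2B/= opprB addrC subrK.
apply/cvg_ex; exists l; apply/cvgrPdist_lt => e e0.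
have e20 : 0 < e / 2 by rewrite divr_gt0.
have [x Fx] := (cauchyP F).1 Fc _ e20.
apply: filterS (Fx) => y; rewrite -ball_normE/= => xy.
rewrite (splitr e) -[l - y](subrKA x) (le_lt_trans (ler_normD _ _))//.
rewrite ler_ltD// distrC; apply: l2_norm_le; first exact: ltW.
move=> N; have := dist_le _ _ Fx e20 N; congr (_ <= _).
by congr (series _ N); apply/funext => n; rewrite l2B la.
Qed.

HB.instance Definition _ := Uniform_isComplete.Build (l2 w) l2_complete.

HB.instance Definition _ := NormedModule_hasInner.Build R (l2 w)
  (@l2_innerC R w) (@l2_innerDl R w) (@l2_innerZl R w)
  (fun x => esym (l2_normE x)).

End l2_complete.

Lemma fmap_ultra (T U : Type) (f : T -> U) (F : set_system T) :
  UltraFilter F -> UltraFilter (f @ F).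
Proof.
move=> FU; split; first exact: fmap_proper_filter.
move=> G GF FG; apply/seteqP; split=> // A GA.
have [//|FnA] := in_ultra_setVsetC (f @^-1` A) FU.
have /(filterI GA) : G (~` A) by exact: FG.
by rewrite setICr => /filter_not_empty.
Qed.

Section l2_compact_dense.
Context {R : realType}.

Lemma l2_compact (v w : weight R) (i : l2 v -> l2 w) :
  (forall x n, i x n = x n) ->
  (forall e : R, 0 < e -> exists N, forall n, (N <= n)%N -> w n <= e * v n) ->
  compact_operator i.
Proof.
move=> iE vw B /ex_strict_bound_gt0[M M0 BM].
pose K := i @` [set x | `|x| <= M].
apply: (@precompact_subset _ _ K); first exact/image_subset/(fun x Bx => ltW (BM x Bx)).
apply: compact_precompact; first exact: norm_hausdorff.
rewrite compact_ultra => F FU FK.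
have coordc n : exists a : R, (fun y : l2 w => y n) @ F --> a.
  have := @segment_compact R (- ((Num.sqrt (v n))^-1 * M))
    ((Num.sqrt (v n))^-1 * M).
  rewrite compact_ultra => /(_ _ (fmap_ultra (fun y : l2 w => y n) FU)).
  case; last by move=> a [_ Fa]; exists a.
  change (F ((fun y : l2 w => y n) @^-1`
    `[- ((Num.sqrt (v n))^-1 * M), (Num.sqrt (v n))^-1 * M])).
  apply: filterS FK => _ [x /= xM <-].
  rewrite in_itv/= iE -ler_norml (le_trans (l2_coord_norm x n))//.
  by rewrite ler_wpM2l// invr_ge0 sqrtr_ge0.
have [a ca] := choice coordc.
have vM (x : l2 v) C N : `|x| <= C ->
    series (fun n => v n * x n ^+ 2) N <= C ^+ 2.
  move=> xC; apply: le_trans (l2_inner_ge x N) _.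
  by rewrite -l2_normE ler_pXn2r// nnegrE// (le_trans _ xC).
have aM N : series (fun n => v n * (0 - a n) ^+ 2) N <= M ^+ 2.
  apply: (sq_series_lim_le ca (b := fun=> 0)).
  apply: filterS FK => _ [x xM <-].
  apply: le_trans (vM _ _ N xM).
  rewrite le_eqVlt; apply/orP; left; apply/eqP; congr (series _ N).
  by apply/funext => n; rewrite iE sub0r sqrrN.
have aE : (fun n => v n * (0 - a n) ^+ 2) = fun n => v n * a n ^+ 2.
  by apply/funext => n; rewrite sub0r sqrrN.
rewrite aE in aM.
have [av _] := square_summable_bound aM.
pose p := L2 av.
have pM : `|p| <= M by apply: l2_norm_le => //; exact: ltW.
exists (i p); split; first by exists p.
apply/cvgrPdist_le => e e0.
pose d := e ^+ 2 / 2 / (M + M) ^+ 2.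
have d0 : 0 < d by rewrite !divr_gt0// exprn_gt0// addr_gt0.
have [N Nw] := vw d d0.
have small : \forall y \near F,
    series (fun n => w n * (a n - (y : l2 w) n) ^+ 2) N <= e ^+ 2 / 2.
  have := cvg_sq_series (w := w) (b := a) ca (N := N).
  have -> : series (fun n => w n * (a n - a n) ^+ 2) N = 0.
    by rewrite /series/= big1// => n _; rewrite subrr expr0n mulr0.
  by move=> /(_ _)/cvgr_le; apply; rewrite divr_gt0// exprn_gt0.
apply: filterS2 FK small => _ [x xM <-] small.
apply: l2_norm_le; first exact: ltW.
have wE : (fun n => w n * (i p - i x) n ^+ 2) =
          (fun n => w n * (a n - i x n) ^+ 2).
  by apply/funext => n; rewrite l2B iE.
move=> N'; rewrite wE.
have [N'N|NN'] := leqP N' N.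
  apply: (@le_trans _ _ (e ^+ 2 / 2)); last first.
    by rewrite ler_pdivrMr// ler_peMr ?sqr_ge0// ler1n.
  apply: le_trans small; rewrite -wE.
  exact: sq_series_nd.
rewrite (splitr (e ^+ 2)) -lerBlDl.
apply: le_trans (_ : series (fun n => w n * (a n - i x n) ^+ 2) N' -
  series (fun n => w n * (a n - i x n) ^+ 2) N <= _).
  by rewrite lerB.
rewrite sub_series_geq ?(ltnW NN')//.
apply: le_trans (_ : d * (series (fun n => v n * (p - x) n ^+ 2) N' -
  series (fun n => v n * (p - x) n ^+ 2) N) <= _).
  rewrite sub_series_geq ?(ltnW NN')// mulr_sumr big_nat [leRHS]big_nat.
  apply: ler_sum => n /andP[Nn _]; rewrite iE l2B/= [leRHS]mulrA.
  by rewrite ler_wpM2r ?sqr_ge0// Nw.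
apply: (@le_trans _ _ (d * (M + M) ^+ 2)).
  rewrite ler_wpM2l ?(ltW d0)//.
  apply: le_trans (vM (p - x) (M + M) N' _); last first.
    by rewrite (le_trans (ler_normB _ _))// lerD.
  rewrite gerBl; apply: sumr_ge0 => n _; exact: sq_ge0.
by rewrite /d divfK// gt_eqF// exprn_gt0// addr_gt0.
Qed.

Definition truncation (x : nat -> R) N n : R := if (n < N)%N then x n else 0.

Lemma truncation_summable (w : weight R) x N :
  truncation x N \in square_summable w.
Proof.
suff h N' : series (fun n => w n * truncation x N n ^+ 2) N' <=
    series (fun n => w n * truncation x N n ^+ 2) N.
  exact: (square_summable_bound h).1.
have [N'N|NN'] := leqP N' N; first exact: sq_series_nd.
rewrite -subr_le0 sub_series_geq ?(ltnW NN')// big_nat big1// => n /andP[Nn _].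
by rewrite /truncation ltnNge Nn/= expr0n mulr0.
Qed.

Lemma truncation_dense (w : weight R) (S : set (l2 w)) :
  (forall x N, S (L2 (truncation_summable w x N))) -> dense S.
Proof.
move=> St O [x Ox] Oo.
have /nbhs_ballP[e /= e0 xeO] : nbhs x O by exact: open_nbhs_nbhs.
have cx := l2_summable x; have /asboolP := cx.
move=> /cvgrPdist_lt/(_ (e ^+ 2 / 4)).
case; first by rewrite divr_gt0// exprn_gt0.
move=> N _ /(_ N (leqnn N)).
have xN N' := square_summable_le cx N'.
rewrite ger0_norm ?subr_ge0// => xNe.
exists (L2 (truncation_summable w x N)); split; last exact: St.
apply: xeO; rewrite -ball_normE/=.
apply: (@le_lt_trans _ _ (e / 2)); last by rewrite ltr_pdivrMr// ltr_pMr// ltr1n.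
apply: l2_norm_le => [|N']; first by rewrite divr_ge0// ltW.
set u := fun n => _.
have u0 n : (n < N)%N -> u n = 0.
  by move=> nN; rewrite /u l2B/= /truncation nN subrr expr0n mulr0.
have uN : series u N = 0.
  by rewrite /series/= big_nat big1// => n /andP[_]; exact: u0.
have [N'N|NN'] := leqP N' N.
  apply: le_trans (_ : series u N <= _); first exact: sq_series_nd.
  by rewrite uN sqr_ge0.
rewrite -[series u N']subr0 -uN sub_series_geq ?(ltnW NN')//.
have -> : \sum_(N <= k < N') u k = \sum_(N <= k < N') w k * x k ^+ 2.
  apply: eq_big_nat => n /andP[Nn _].
  by rewrite /u l2B/= /truncation ltnNge Nn/= subr0.
rewrite -(sub_series_geq (fun k => w k * x k ^+ 2)) ?(ltnW NN')//.
apply: le_trans (_ : e ^+ 2 / 4 <= _); last by rewrite expr_div_n; lra.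
by apply: le_trans (ltW xNe); rewrite lerB.
Qed.

End l2_compact_dense.

(* A positive unbounded monotone function is necessarily nondecreasing. *)
Record growth (R : realType) := Growth {
  growth_fun :> nat -> R;
  growth_gt0 : forall n, 0 < growth_fun n;
  growth_nondecreasing : nondecreasing_seq growth_fun;
  growth_unbounded : forall M : R, exists n, M < growth_fun n
}.

Section l2_scale.
Context {R : realType} (f : growth R).

Definition growth_weight (k : nat) : weight R :=
  Weight (fun n => exprn_gt0 k (growth_gt0 f n)).

Definition l2_level (k : nat) : hilbertType R := l2 (growth_weight k).

Lemma growth_summableS k (x : nat -> R) :
  x \in square_summable (growth_weight k.+1) ->
  x \in square_summable (growth_weight k).
Proof.
move=> /asboolP cx; apply/asboolP.
apply: (@series_le_cvg _ _
  ((f 0%N)^-1 *: (fun n => f n ^+ k.+1 * x n ^+ 2))) => [n|n|n|].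
- exact: (@sq_ge0 _ (growth_weight k)).
- rewrite mulr_ge0 ?invr_ge0 ?(ltW (growth_gt0 f 0))//.
  exact: (@sq_ge0 _ (growth_weight k.+1)).
- rewrite -[leRHS]/((f 0%N)^-1 * (f n ^+ k.+1 * x n ^+ 2)).
  rewrite /= (exprS (f n)) [leRHS]mulrA ler_wpM2r ?sqr_ge0// mulrA ler_peMl//.
    by rewrite exprn_ge0 ?(ltW (growth_gt0 f n)).
  by rewrite ler_pdivlMl ?growth_gt0// mulr1 growth_nondecreasing.
- exact: is_cvg_seriesZ.
Qed.

Definition l2_incl_fun k (x : l2_level k.+1) : l2_level k :=
  L2 (growth_summableS (l2_summable x)).

Lemma l2_incl_linear k : linear (@l2_incl_fun k).
Proof. by move=> a x y; exact: val_inj. Qed.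

HB.instance Definition _ k := GRing.isLinear.Build R (l2_level k.+1)
  (l2_level k) _ (@l2_incl_fun k) (@l2_incl_linear k).

Definition l2_incl k : {linear l2_level k.+1 -> l2_level k} := @l2_incl_fun k.

Lemma l2_incl_inj k : injective (l2_incl k).
Proof. by move=> x y /(congr1 val) xy; exact: val_inj. Qed.

Lemma l2_incl_compact k : compact_operator (l2_incl k).
Proof.
apply: l2_compact => // e e0.
have [N Ne] := growth_unbounded f e^-1.
exists N => n Nn /=; rewrite exprS mulrA ler_peMl//.
  by rewrite exprn_ge0 ?(ltW (growth_gt0 f n)).
rewrite -ler_pdivrMl// mulr1 (le_trans (ltW Ne))//.
exact: growth_nondecreasing.
Qed.

Lemma l2_emb_seq k (x : l2_level k) n : (tower_emb l2_incl x : l2 _) n = x n.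
Proof. by elim: k x => [//|k IH] x; rewrite IH. Qed.

Lemma l2_infty_dense k :
  dense (tower_emb l2_incl (k := k) @^-1` tower_infty l2_incl).
Proof.
apply: truncation_dense => x N n _.
exists (L2 (truncation_summable (growth_weight n) x N)) => //.
by apply: val_inj; apply/funext => m /=; rewrite !l2_emb_seq.
Qed.

Definition l2_scale : scaleHilbert R :=
  ScaleHilbert l2_incl_inj l2_incl_compact l2_infty_dense.

End l2_scale.

Definition fractal (R : realType) (H : scaleHilbert R) :=
  exists f : growth R, scale_isomorphic H (l2_scale f).

(* Main.v *)
Require Import Defs.
From HB Require Import structures.
From mathcomp Require Import all_boot all_order all_algebra.
From mathcomp Require Import all_classical all_reals interval_inference.
From mathcomp Require Import topology normedtype sequences derive.
From mathcomp Require Import ring lra.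

Set Implicit Arguments.
Unset Strict Implicit.
Unset Printing Implicit Defensive.

Import Order.TTheory GRing.Theory Num.Theory.
Import numFieldNormedType.Exports.

Local Open Scope classical_set_scope.
Local Open Scope ring_scope.

(** Let [A] be a scale Hessian operator. The kernel of [A] consists of smooth
    vectors by regularity, and since the index is zero it is, seen in [H 0], the
    whole orthogonal complement of the closed range of [A]. Adding to [A] the
    finite rank operator [x |-> \sum_i <x, u_i> u_i] attached to a basis [u] of the
    kernel therefore gives an operator [B] which is still symmetric, continuous
    on every level and regular, and which is moreover a bijection from [H 1] to
    [H 0] ([invertible_hessian]).

    Let [T] be the inverse of [B] followed by the inclusion of [H 1] into [H 0].
    It is injective and symmetric, and it is compact because the inclusion is
    ([compact_inverse]). By the spectral theorem for compact symmetric operators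
    ([spectral_theorem]) there are an orthonormal basis [e] and eigenvalues
    [mu n] of [T] whose absolute values decrease to zero. Regularity says that
    level [k] of the scale is the range of [T ^ k], and for an [x] with
    coordinates [x_n] this means that the sum of [(mu n)^-2k * x_n ^ 2] is
    finite. So the coordinate map is a bijection of level [k] onto the weighted
    sequence space of [f ^ k], where [f n = (mu n)^-2] ([fractal_of_invertible]).
    It is continuous on level [k] because the weighted norm of the coordinates of
    [T ^ k y] is the norm of [y], and [y] is obtained from [T ^ k y] by applying
    [k] times the continuous restrictions of [B]. *)

(** * Geometry of Hilbert spaces *)

Section inner_product.
Context {R : realType} {E : hilbertType R}.
Implicit Types x y z : E.

Lemma innerDr x y z : inner x (y + z) = inner x y + inner x z.
Proof. by rewrite innerC innerDl !(innerC x). Qed.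

Lemma innerZr (a : R) x y : inner x (a *: y) = a * inner x y.
Proof. by rewrite innerC innerZl innerC. Qed.

Lemma inner0l x : inner 0 x = 0.
Proof. by rewrite -(scale0r x) innerZl mul0r. Qed.

Lemma inner0r x : inner x 0 = 0.
Proof. by rewrite innerC inner0l. Qed.

Lemma innerNl x y : inner (- x) y = - inner x y.
Proof. by rewrite -scaleN1r innerZl mulN1r. Qed.

Lemma innerNr x y : inner x (- y) = - inner x y.
Proof. by rewrite innerC innerNl innerC. Qed.

Lemma innerBl x y z : inner (x - y) z = inner x z - inner y z.
Proof. by rewrite innerDl innerNl. Qed.

Lemma inner_suml (I : Type) (r : seq I) (P : pred I) (F : I -> E) y :
  inner (\sum_(i <- r | P i) F i) y = \sum_(i <- r | P i) inner (F i) y.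
Proof.
by elim/big_rec2 : _ => [|i u v _ <-]; rewrite ?inner0l// innerDl.
Qed.

Lemma inner_sumr (I : Type) (r : seq I) (P : pred I) (F : I -> E) y :
  inner y (\sum_(i <- r | P i) F i) = \sum_(i <- r | P i) inner y (F i).
Proof. by rewrite innerC inner_suml; under eq_bigr do rewrite innerC. Qed.

Lemma inner_self_eq0 x : inner x x = 0 -> x = 0.
Proof. by rewrite inner_norm => /eqP; rewrite sqrf_eq0 normr_eq0 => /eqP. Qed.

Lemma normD_sq x y :
  `|x + y| ^+ 2 = `|x| ^+ 2 + 2 * inner x y + `|y| ^+ 2.
Proof.
rewrite -!inner_norm innerDl !innerDr (innerC y x); ring.
Qed.

Lemma normB_sq x y :
  `|x - y| ^+ 2 = `|x| ^+ 2 - 2 * inner x y + `|y| ^+ 2.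
Proof. by rewrite normD_sq innerNr mulrN normrN. Qed.

Lemma cauchy_schwarz x y : `|inner x y| <= `|x| * `|y|.
Proof.
suff h z : inner z y <= `|z| * `|y|.
  by rewrite ler_norml h andbT lerNl -innerNl -(normrN x) h.
have [->|z0] := eqVneq z 0; first by rewrite inner0l normr0 mul0r.
have [->|y0] := eqVneq y 0; first by rewrite inner0r normr0 mulr0.
have nz : 0 < `|z| by rewrite normr_gt0.
have ny : 0 < `|y| by rewrite normr_gt0.
have := sqr_ge0 `| `|y| *: z - `|z| *: y|.
rewrite normB_sq innerZl innerZr !normrZ !normr_id => h.
rewrite -(ler_pM2l (mulr_gt0 nz ny)); nra.
Qed.

Lemma inner_continuous y : continuous (fun x => inner x y).
Proof.
move=> x; apply/cvgrPdist_lt => e e0.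
have y1 : 0 < `|y| + 1 by rewrite ltr_wpDl.
have /cvgrPdist_lt/(_ (e / (`|y| + 1))) : (id : E -> E) @ x --> x by exact: cvg_id.
move=> /(_ (divr_gt0 e0 y1)); apply: filterS => z xz /=.
rewrite -innerBl (le_lt_trans (cauchy_schwarz _ _))//.
have := xz; rewrite ltr_pdivlMr// => xz'; apply: le_lt_trans xz'.
by rewrite ler_wpM2l// lerDl.
Qed.

Lemma cvg_inner (T : Type) (F : set_system T) {FF : Filter F}
    (f : T -> E) x (y : E) :
  f @ F --> x -> (fun t => inner (f t) y) @ F --> inner x y.
Proof.
by move=> fx; exact: (continuous_cvg _ (@inner_continuous y x) fx).
Qed.

Lemma closed_inner_eq0 y : closed [set x | inner x y = 0].
Proof.
apply: (@closed_comp _ _ (fun x => inner x y) [set 0]); last exact: closed_eq.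
by move=> x _; exact: inner_continuous.
Qed.

(** A minimising sequence for the distance to [M] is Cauchy by the
    parallelogram identity, and its limit is the foot of the perpendicular. *)
Lemma projection_exists (M : set E) x :
  M !=set0 -> (forall (a : R) u v, M u -> M v -> M (a *: u + v)) -> closed M ->
  exists2 m, M m & forall z, M z -> inner (x - m) z = 0.
Proof.
move=> [u0 Mu0] Mlin Mcl.
pose D := [set `|x - u| ^+ 2 | u in M].
have Dlb : lbound D 0 by move=> _ [u _ <-]; rewrite sqr_ge0.
have Dinf : has_inf D by split; [exists (`|x - u0| ^+ 2); exists u0|exists 0].
have dle u : M u -> inf D <= `|x - u| ^+ 2.
  by move=> Mu; apply: ge_inf; [exact: Dinf.2|exists u].
have /choice[m mP] (n : nat) :
    exists u, M u /\ `|x - u| ^+ 2 < inf D + n.+1%:R^-1.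
  have n0 : 0 < n.+1%:R^-1 :> R by rewrite invr_gt0.
  have [_ [u Mu <-] uP] := inf_adherent n0 Dinf.
  by exists u.
have midM u v : M u -> M v -> M (2^-1 *: u + 2^-1 *: v).
  move=> Mu Mv; apply: (Mlin) => //.
  have M0 : M 0 by rewrite -(addNr u) -scaleN1r; exact: Mlin.
  by rewrite -[_ *: v]addr0; exact: Mlin.
have close N n p : (N <= n)%N -> (N <= p)%N ->
    `|m n - m p| ^+ 2 <= 4 * N.+1%:R^-1.
  move=> Nn Np; have [Mn Ln] := mP n; have [Mp Lp] := mP p.
  have iN q : (N <= q)%N -> q.+1%:R^-1 <= N.+1%:R^-1 :> R.
    by move=> Nq; rewrite lef_pV2 ?posrE// ler_nat.
  have := dle _ (midM _ _ Mn Mp).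
  have -> : x - (2^-1 *: m n + 2^-1 *: m p) =
      2^-1 *: ((x - m n) + (x - m p)).
    have half : 2^-1 *: (x + x) = x.
      by rewrite -mulr2n -(scaler_nat 2 x) scalerA mulVf ?scale1r// pnatr_eq0.
    by rewrite addrACA -opprD scalerBr half scalerDr.
  have -> : m n - m p = (x - m p) - (x - m n).
    by rewrite opprB [RHS]addrC subrKA.
  rewrite normrZ exprMn (normD_sq (x - m n)) (normB_sq (x - m p)).
  rewrite (innerC (x - m p) (x - m n)).
  rewrite ger0_norm ?invr_ge0// exprVn -natrX.
  have := iN _ Nn; have := iN _ Np.
  move: Ln Lp.
  move: (n.+1%:R^-1) (p.+1%:R^-1) (N.+1%:R^-1) => ? ? ?.
  lra.
have : cvg (m @ \oo).
  apply: cauchy_cvg; apply: cauchy_exP => e e0.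
  have e4 : 0 < e ^+ 2 / 4 by rewrite divr_gt0// exprn_gt0.
  have [N _ /(_ N (leqnn N)) NP] := near_infty_natSinv_lt (PosNum e4).
  exists (m N); exists N => // p /= Np; rewrite -ball_normE/=.
  rewrite -(@ltr_pXn2r _ 2)// ?nnegrE ?(ltW e0)//.
  apply: le_lt_trans (close N _ _ (leqnn N) Np) _.
  by move: NP => /=; rewrite ltr_pdivlMr// mulrC.
move=> /cvg_ex[l ml].
have Ml : M l.
  apply: (closed_cvg M Mcl _ l ml); apply: nearW => n; exact: (mP n).1.
have ld : `|x - l| ^+ 2 <= inf D.
  apply/ler_addgt0Pr => e e0.
  have c : (fun n => `|x - m n| ^+ 2) @ \oo --> `|x - l| ^+ 2.
    under eq_cvg do rewrite expr2.
    by rewrite expr2; apply: cvgM; apply: cvg_norm; apply: cvgB => //;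
      exact: cvg_cst.
  apply: (cvgr_to_le c).
  apply: filterS (near_infty_natSinv_lt (PosNum e0)) => n /= ne.
  by apply: ltW; apply: lt_trans (mP n).2 _; rewrite ltrD2l.
exists l => // z Mz.
(* This [t] minimises the distance from [x] to [l + t *: z], up to the [1] that
   keeps the denominator away from zero. *)
set a := inner (x - l) z; pose t := a / (`|z| ^+ 2 + 1).
have := dle _ (Mlin t _ _ Mz Ml).
have -> : x - (t *: z + l) = (x - l) - t *: z by rewrite opprD addrA addrAC.
rewrite normB_sq innerZr -/a normrZ exprMn real_normK ?num_real// => h.
have b1 : 0 < `|z| ^+ 2 + 1 by rewrite ltr_wpDl ?sqr_ge0.
have b0 := sqr_ge0 `|z|.
have ta : a = t * (`|z| ^+ 2 + 1) by rewrite divfK ?gt_eqF.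
have : t = 0 by move: h; rewrite ta => h; nra.
by rewrite ta => ->; rewrite mul0r.
Qed.

End inner_product.

Section orthonormal_sequences.
Context {R : realType} {E : hilbertType R} (e : nat -> E).
Hypothesis orthonormal : forall i j, inner (e i) (e j) = (i == j)%:R.

Lemma inner_sum_orthonormal (c : nat -> R) m n j :
  inner (\sum_(m <= i < n) c i *: e i) (e j) =
  if (m <= j < n)%N then c j else 0.
Proof.
rewrite inner_suml.
under eq_bigr do rewrite innerZl orthonormal.
have [jmn|jmn] := boolP (m <= j < n)%N.
  rewrite (bigD1_seq j) ?iota_uniq//= ?mem_index_iota// eqxx mulr1.
  by rewrite big1 ?addr0// => i /negPf ->; rewrite mulr0.
rewrite big_nat big1// => i imn; case: eqP => [ij|]; last by rewrite mulr0.
by rewrite -ij imn in jmn.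
Qed.

Lemma norm_sum_orthonormal (c : nat -> R) m n :
  `|\sum_(m <= i < n) c i *: e i| ^+ 2 = \sum_(m <= i < n) c i ^+ 2.
Proof.
rewrite -inner_norm inner_sumr big_nat [RHS]big_nat; apply: eq_bigr => j jmn.
by rewrite innerZr inner_sum_orthonormal jmn expr2.
Qed.

Lemma bessel x n : \sum_(0 <= i < n) inner x (e i) ^+ 2 <= `|x| ^+ 2.
Proof.
have := sqr_ge0 `|x - \sum_(0 <= i < n) inner x (e i) *: e i|.
rewrite normB_sq norm_sum_orthonormal inner_sumr.
under [in 2 * _]eq_bigr do rewrite innerZr -expr2.
lra.
Qed.

(** The norm of a block of the vector series is the square root of the
    corresponding block of the scalar series, so both are Cauchy together. *)
Lemma riesz_fischer (c : nat -> R) :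
  cvgn (series (fun n => c n ^+ 2)) ->
  exists y, forall n, inner y (e n) = c n.
Proof.
move=> cc.
have : cvgn (series (fun n => c n *: e n)).
  apply: cauchy_cvg; apply/cauchy_seriesP => d d0.
  have d20 : 0 < d ^+ 2 by rewrite exprn_gt0.
  have /cauchy_seriesP/(_ _ d20) : cauchy (series (fun n => c n ^+ 2) @ \oo).
    exact: cvg_cauchy.
  apply: filterS => -[m n] /=; rewrite -norm_sum_orthonormal.
  by rewrite ger0_norm ?sqr_ge0// ltr_pXn2r ?nnegrE// ltW.
move=> /cvg_ex[y cy]; exists y => n.
have c1 := cvg_inner (FF := _) (y := e n) cy.
suff c2 : (fun N => inner (series (fun n => c n *: e n) N) (e n)) @ \oo --> c n.
  by rewrite -(cvg_lim (@Rhausdorff R) (c1 _)) (cvg_lim (@Rhausdorff R) c2).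
apply: cvg_near_cst; exists n.+1 => // N /= nN.
by rewrite /series/= inner_sum_orthonormal leq0n nN.
Qed.

End orthonormal_sequences.

(** * Compact symmetric operators *)

Lemma bounded_set_norm_le {R : realType} {V : normedModType R} (A : set V) (M : R) :
  (forall x, A x -> `|x| <= M) -> bounded_set A.
Proof.
move=> AM; exists M; split; first exact: num_real.
by move=> N MN x /AM/= xM; rewrite (le_trans xM)// ltW.
Qed.

Section compact_operators.
Context {R : realType} {E F : normedModType R} (T : {linear E -> F}).

Lemma compact_operator_bounded : compact_operator T ->
  exists2 C, 0 < C & forall x, `|T x| <= C * `|x|.
Proof.
move=> Tc; have : precompact (T @` [set x | `|x| <= 1]).
  by apply: Tc; apply: (@bounded_set_norm_le _ _ _ 1).
rewrite precompactE => /compact_bounded/ex_strict_bound_gt0[C C0 CP].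
exists C => // x; have [->|x0] := eqVneq x 0; first by rewrite linear0 !normr0 mulr0.
have nx : 0 < `|x| by rewrite normr_gt0.
have : `|T (`|x|^-1 *: x)| < C.
  apply: CP; apply: subset_closure; exists (`|x|^-1 *: x) => //=.
  by rewrite normrZ normfV normr_id mulVf ?gt_eqF.
by rewrite linearZ normrZ normfV normr_id ltr_pdivrMl// mulrC => /ltW.
Qed.

Lemma bounded_operator_continuous C : 0 < C ->
  (forall x, `|T x| <= C * `|x|) -> continuous T.
Proof.
move=> C0 CP x; apply/cvgrPdist_lt => d d0.
have /cvgrPdist_lt/(_ _ (divr_gt0 d0 C0)) : (id : E -> E) @ x --> x.
  exact: cvg_id.
apply: filterS => z /= xz; rewrite -linearB (le_lt_trans (CP _))//.
by rewrite mulrC -ltr_pdivlMr.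
Qed.

Lemma compact_operator_continuous : compact_operator T -> continuous T.
Proof.
by move=> /compact_operator_bounded[C C0]; exact: bounded_operator_continuous.
Qed.

End compact_operators.

Section compact_self_adjoint.
Context {R : realType} {E : hilbertType R} (T : {linear E -> E}).
Hypothesis compactT : compact_operator T.
Hypothesis symmetricT : forall x y, inner (T x) y = inner x (T y).

Lemma norm_sq_symmetric x : inner (T (T x)) x = `|T x| ^+ 2.
Proof. by rewrite symmetricT inner_norm. Qed.

(** The norm attains its maximum [s] over the compact closure [K] of the image
    under [T] of the unit ball of [M], say at [c], and [s] is then the norm of
    [T] on [M]. Symmetry gives [`|w| ^+ 2 <= `|T w|] on that image, hence on [K],
    so that [`|T c| = s * `|c|]: the operator [T ^ 2 - s ^ 2] vanishes at [c] by
    the equality case of the Cauchy-Schwarz inequality, and one of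
    [T c + s *: c] and [c] is an eigenvector of [T]. *)
Lemma maximal_eigenvector (M : set E) :
  (forall (a : R) u v, M u -> M v -> M (a *: u + v)) -> closed M ->
  (forall x, M x -> M (T x)) -> (exists2 x, M x & T x != 0) ->
  exists e mu, [/\ M e, `|e| = 1, T e = mu *: e, mu != 0
    & forall v, M v -> `|T v| <= `|mu| * `|v|].
Proof.
move=> Mlin Mcl MT [x0 Mx0 Tx0].
have M0 : M 0 by rewrite -(addNr x0) -scaleN1r; exact: Mlin.
have MZ a u : M u -> M (a *: u) by move=> Mu; rewrite -[_ *: _]addr0; exact: Mlin.
pose K := closure (T @` [set x | M x /\ `|x| <= 1]).
have cK : compact K.
  rewrite /K -precompactE; apply: compactT.
  by apply: (@bounded_set_norm_le _ _ _ 1) => x [].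
have KM : K `<=` M.
  rewrite (closure_id M).1//; apply: closureS => _ [x [Mx _] <-]; exact: MT.
have cT := compact_operator_continuous compactT.
have KT w : K w -> `|w| ^+ 2 <= `|T w|.
  pose g (w : E) := `|T w| - `|w| ^+ 2.
  have cg : continuous g.
    move=> z; apply: cvgB; first by apply: cvg_norm; exact: cT.
    rewrite expr2; under eq_cvg do rewrite expr2.
    by apply: cvgM; apply: cvg_norm; exact: cvg_id.
  have gcl : closed (g @^-1` [set y | 0 <= y]).
    by apply: closed_comp; [move=> z _; exact: cg|exact: closed_ge].
  move=> Kw; rewrite -subr_ge0.
  suff : K `<=` g @^-1` [set y | 0 <= y] by move=> /(_ w Kw).
  rewrite [X in _ `<=` X](closure_id _).1//; apply: closureS.
  move=> _ [x [Mx x1] <-] /=; rewrite /g subr_ge0.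
  rewrite -norm_sq_symmetric (le_trans (ler_norm _))//.
  by rewrite (le_trans (cauchy_schwarz _ _))// ler_piMr.
have [c cK' cmax] : exists2 c, c \in K & forall t, t \in K -> `|t| <= `|c|.
  apply: (@compact_EVT_max E R (fun x : E => `|x|)) => //.
    exists 0; apply: subset_closure; exists 0; last exact: linear0.
    by split => //; rewrite normr0.
  by apply: continuous_subspaceT => x; exact: norm_continuous.
have {}cK' : K c by exact/set_mem.
have Mc := KM _ cK'.
set s := `|c|.
have Ts v : M v -> `|T v| <= s * `|v|.
  move=> Mv; have [->|v0] := eqVneq v 0.
    by rewrite linear0 !normr0 mulr0.
  have nv : 0 < `|v| by rewrite normr_gt0.
  have : `|T (`|v|^-1 *: v)| <= s.
    apply: cmax; apply/mem_set; apply: subset_closure.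
    exists (`|v|^-1 *: v) => //; split; first exact: MZ.
    by rewrite normrZ normfV normr_id mulVf ?gt_eqF.
  by rewrite linearZ normrZ normfV normr_id ler_pdivrMl// mulrC.
have s0 : 0 < s.
  rewrite lt_def normr_ge0 andbT; apply: contraNneq Tx0 => s0.
  by rewrite -normr_le0 (le_trans (Ts _ Mx0))// s0 mul0r.
have Tc : `|T c| = s ^+ 2.
  by apply/eqP; rewrite eq_le KT// andbT expr2 Ts.
have TTc : T (T c) = s ^+ 2 *: c.
  apply/eqP; rewrite -subr_eq0 -normr_eq0 -sqrf_eq0 eq_le sqr_ge0 andbT.
  rewrite normB_sq innerZr norm_sq_symmetric Tc normrZ -/s.
  rewrite (ger0_norm (sqr_ge0 s)).
  have : `|T (T c)| ^+ 2 <= (s * s ^+ 2) ^+ 2.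
    by rewrite ler_pXn2r ?nnegrE ?mulr_ge0 ?sqr_ge0 ?(ltW s0)// -Tc Ts//; exact: MT.
  nra.
(* [T ^ 2 - s ^ 2] factors as [(T - s) (T + s)] and kills [c]. *)
have [Tsc|Tsc] := eqVneq (T c + s *: c) 0.
  exists (s^-1 *: c), (- s); split.
  - exact: MZ.
  - by rewrite normrZ normfV ger0_norm ?(ltW s0)// mulVf ?gt_eqF.
  - rewrite linearZ /= (_ : T c = - (s *: c)); last by apply/eqP; rewrite -addr_eq0 Tsc.
    by rewrite scalerN scaleNr scalerA scalerA mulrC.
  - by rewrite oppr_eq0 gt_eqF.
  - by rewrite normrN ger0_norm ?(ltW s0).
have nz : 0 < `|T c + s *: c| by rewrite normr_gt0.
exists (`|T c + s *: c|^-1 *: (T c + s *: c)), s; split.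
- by apply: MZ; rewrite addrC; apply: Mlin => //; exact: MT.
- by rewrite normrZ normfV normr_id mulVf ?gt_eqF.
- rewrite linearZ /=; have -> : T (T c + s *: c) = s *: (T c + s *: c).
    by rewrite linearD linearZ /= TTc scalerDr scalerA -expr2 addrC.
  by rewrite !scalerA mulrC.
- by rewrite gt_eqF.
- by rewrite ger0_norm ?(ltW s0).
Qed.

Hypothesis injectiveT : forall x, T x = 0 -> x = 0.
Hypothesis infinite_dim : ~ finite_dimensional [set: E].

Definition orthonormal_below (u : nat -> E) (n : nat) :=
  forall i j, (i < n)%N -> (j < n)%N -> inner (u i) (u j) = (i == j)%:R.

Definition orthogonal_below (u : nat -> E) (n : nat) : set E :=
  [set x | forall i, (i < n)%N -> inner x (u i) = 0].

Lemma orthogonal_below_closed u n : closed (orthogonal_below u n).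
Proof.
rewrite (_ : orthogonal_below u n =
    \bigcap_(i in [set i | (i < n)%N]) [set x | inner x (u i) = 0]).
  by apply: closed_bigI => i _; exact: closed_inner_eq0.
by apply/seteqP; split => x xP i; exact: xP.
Qed.

(** Otherwise the first [n] vectors would be a basis of the whole space. *)
Lemma orthogonal_below_nontrivial u n : orthonormal_below u n ->
  exists2 x, orthogonal_below u n x & x != 0.
Proof.
move=> uo; apply: contrapT => noM; apply: infinite_dim; exists n.
exists (fun i : 'I_n => u i).
have innerS (c : 'I_n -> R) j : inner (\sum_i c i *: u i) (u (j : 'I_n)) = c j.
  rewrite inner_suml (bigD1 j)//= innerZl uo// eqxx mulr1 big1 ?addr0// => i ij.
  by rewrite innerZl uo// (negPf (ij : (i != j :> nat))) mulr0.
split => [c c0 i|]; first by rewrite -innerS c0 inner0l.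
apply/seteqP; split => // x _; exists (fun i : 'I_n => inner x (u i)) => //.
apply/esym/eqP; rewrite -subr_eq0; apply/negP => /negP x0; apply: noM.
exists (x - \sum_(i < n) inner x (u i) *: u i) => // i i_n.
by rewrite innerBl (innerS _ (Ordinal i_n)) subrr.
Qed.

(** The last clause, maximality of the eigenvalue on the orthogonal complement of
    the previous vectors, gives both the monotonicity of the eigenvalues and the
    completeness of the eigenvectors. *)
Let next_spec (u : nat -> E) (n : nat) (e : E) :=
  [/\ orthogonal_below u n e, `|e| = 1, exists mu, T e = mu *: e
    & forall v, orthogonal_below u n v -> `|T v| <= `|T e| * `|v|].

Let next_exists (u : nat -> E) n : orthonormal_below u n ->
  (forall i, (i < n)%N -> exists mu, T (u i) = mu *: u i) ->
  exists e, next_spec u n e.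
Proof.
move=> uo ue; have [x xu x0] := orthogonal_below_nontrivial uo.
have [||||e [mu [eM e1 Te _ eV]]] := @maximal_eigenvector (orthogonal_below u n).
- move=> a v w vM wM i i_n; rewrite innerDl innerZl vM// wM// mulr0 addr0//.
- exact: orthogonal_below_closed.
- move=> v vM i i_n; have [mu Tu] := ue i i_n.
  by rewrite symmetricT Tu innerZr vM// mulr0.
- by exists x => //; apply: contra_neq x0 => /injectiveT.
exists e; split => //; first by exists mu.
by move=> v /eV; rewrite Te normrZ e1 mulr1.
Qed.

(** Eigenvectors are chosen one after the other in the orthogonal complement of
    the previous ones, which [T] preserves by symmetry, each with the largest
    possible eigenvalue. If the eigenvalues stayed away from zero, the vectors
    [T (e n)] would keep a fixed distance from each other inside a compact set.
    A vector [x] orthogonal to all [e n] satisfies [`|T x| <= `|mu n| * `|x|] for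
    all [n], so [T x = 0] and [x = 0]. *)
Lemma spectral_theorem : exists (e : nat -> E) (mu : nat -> R),
  [/\ forall i j, inner (e i) (e j) = (i == j)%:R,
      forall n, T (e n) = mu n *: e n,
      forall n, mu n != 0 /\ `|mu n.+1| <= `|mu n|,
      forall d, 0 < d -> exists n, `|mu n| < d
    & forall x, (forall n, inner x (e n) = 0) -> x = 0].
Proof.
(* The value [0] is a dummy for lists that are not orthonormal eigenvectors. *)
have /choice[next nextP] (l : seq E) : exists e,
    orthonormal_below (nth 0 l) (size l) ->
    (forall i, (i < size l)%N -> exists mu, T (nth 0 l i) = mu *: nth 0 l i) ->
    next_spec (nth 0 l) (size l) e.
  have [lo|lo] := pselect (orthonormal_below (nth 0 l) (size l)); last by exists 0.
  have [le|le] := pselect (forall i, (i < size l)%N ->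
    exists mu, T (nth 0 l i) = mu *: nth 0 l i); last by exists 0.
  by have [e eP] := next_exists lo le; exists e.
pose es n := iter n (fun l => rcons l (next l)) [::].
pose e n := next (es n).
have esE n : es n = mkseq e n.
  elim: n => [//|n IH]; rewrite -addn1 /mkseq iotaD map_cat /= cats1 add0n.
  by rewrite addn1 /= -/(es n) -/(mkseq e n) -IH.
have below_mkseq n : orthogonal_below (nth 0 (es n)) (size (es n)) =
    orthogonal_below e n.
  rewrite esE size_mkseq; apply/seteqP; split => x xP i i_n.
    by have := xP i i_n; rewrite nth_mkseq.
  by rewrite nth_mkseq//; exact: xP.
have eP n : next_spec e n (e n).
  have [n' ] := ubnP n; elim: n' n => // n' IH n nn'.
  have IHn i : (i < n)%N -> next_spec e i (e i).
    by move=> i_n; apply: IH; apply: leq_trans i_n _.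
  have := nextP (es n); rewrite /next_spec below_mkseq; apply.
    rewrite esE size_mkseq => i j i_n j_n; rewrite !nth_mkseq//.
    have [ij|ji|->] := ltngtP i j.
    - by rewrite innerC; case: (IHn j j_n) => /(_ i ij).
    - by case: (IHn i i_n) => /(_ j ji).
    - by rewrite inner_norm; case: (IHn j j_n) => _ ->; rewrite expr1n.
  rewrite esE size_mkseq => i i_n; rewrite nth_mkseq//.
  by case: (IHn i i_n).
have eo i j : inner (e i) (e j) = (i == j)%:R.
  have [ij|ji|->] := ltngtP i j.
  - by rewrite innerC; case: (eP j) => /(_ i ij).
  - by case: (eP i) => /(_ j ji).
  - by rewrite inner_norm; case: (eP j) => _ ->; rewrite expr1n.
have e1 n : `|e n| = 1 by case: (eP n).
have /choice[mu muP] n : exists mu, T (e n) = mu *: e n by case: (eP n).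
have muE n : `|T (e n)| = `|mu n| by rewrite muP normrZ e1 mulr1.
have mu_max n v : orthogonal_below e n v -> `|T v| <= `|mu n| * `|v|.
  by case: (eP n) => _ _ _ /(_ v); rewrite muE.
have mu_small d : 0 < d -> exists n, `|mu n| < d.
  move=> d0; apply: contrapT => /forallNP large.
  have {}large n : d <= `|mu n| by rewrite leNgt; exact/negP/large.
  have cK : compact (closure (T @` [set x | `|x| <= 1])).
    by rewrite -precompactE; apply: compactT; apply: (@bounded_set_norm_le _ _ _ 1).
  have [|p [_ pcl]] := cK ((T \o e) @ \oo) _.
    apply: (nearW (F := \oo)) => n; apply: subset_closure; exists (e n) => //=.
    by rewrite e1.
  have near N : exists2 n, (N <= n)%N & `|p - T (e n)| < d / 2.
    have d2 : 0 < d / 2 by rewrite divr_gt0.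
    have [_ [[n /= Nn <-]]] := pcl ((T \o e) @` [set n | (N <= n)%N])
      (ball p (d / 2))
      (ex_intro2 _ _ N I (fun n Nn => ex_intro2 _ _ n Nn erefl))
      (nbhsx_ballx _ _ d2).
    by rewrite -ball_normE/= => pn; exists n.
  have [n _ pn] := near 0%N; have [m nm pm] := near n.+1.
  have : `|T (e n) - T (e m)| < d.
    rewrite (splitr d) -(subrKA p) (le_lt_trans (ler_normD _ _))//.
    by rewrite ltrD// distrC.
  rewrite -(@ltr_pXn2r _ 2)// ?nnegrE ?(ltW d0)//.
  rewrite normB_sq !muE !muP innerZl innerZr eo ltn_eqF// !mulr0 subr0.
  have := large n; have := large m; nra.
exists e, mu; split => //.
- move=> n; split.
    apply/eqP => mu0; have := e1 n.
    rewrite (injectiveT (x := e n)) ?normr0.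
      by move/eqP; rewrite eq_sym oner_eq0.
    by rewrite muP mu0 scale0r.
  rewrite -(mulr1 `|mu n|) -(e1 n.+1) -(muE n.+1) mu_max// => i i_n.
  by rewrite eo gtn_eqF// ltnS ltnW.
- move=> x xe; apply: injectiveT; apply/eqP; rewrite -normr_le0.
  apply/ler_addgt0Pr => d d0; rewrite add0r.
  have [n nd] := mu_small (d / (`|x| + 1))
    (divr_gt0 d0 (ltr_wpDl (normr_ge0 x) ltr01)).
  apply: le_trans (mu_max n x (fun i _ => xe i)) _.
  move: nd; rewrite ltr_pdivlMr ?ltr_wpDl// => /ltW; apply: le_trans.
  by rewrite ler_wpM2l// lerDl.
Qed.

End compact_self_adjoint.

(** * Compactness of inverses *)

(** The contrapositive of Baire's theorem for the complements of the [C n]. *)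
Lemma baire_ball {R : realType} {E : completeNormedModType R} (C : nat -> set E) :
  (forall n, closed (C n)) -> \bigcup_n C n = setT ->
  exists n y r, 0 < r /\ forall x, `|x| < r -> C n (y + x).
Proof.
move=> Ccl CT.
have [n nd] : exists n, ~ dense (~` C n).
  apply: contrapT => /forallNP nd.
  have /Baire/(_ setT) : forall n, open (~` C n) /\ dense (~` C n).
    by move=> m; split; [exact: closed_openC|exact: contrapT (nd m)].
  move=> /(_ (ex_intro _ 0 I) openT)[x [_ xC]].
  have [n _ Cn] : (\bigcup_n C n) x by rewrite CT.
  exact: (xC n).
move: nd => /existsNP[O /not_implyP[[y Oy]]]; rewrite not_implyE => -[Oo OC].
have /nbhs_ballP[r /= r0 yr] : nbhs y O by exact: open_nbhs_nbhs.
exists n, y, r; split=> // x xr; apply: contrapT => nC; apply: OC.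
exists (y + x); split=> //; apply: yr.
by rewrite -ball_normE/= opprD addrA subrr sub0r normrN.
Qed.

(** By Baire, [B] of some ball of [E1] is dense in a ball of [E0]. On [B x] the
    operator [J \o S] takes the value [J x], hence it maps that dense subset
    into the compact closure of the image under [J] of a ball. The symmetry of
    [B] bounds [J \o S] there, so this passes to the whole ball of [E0] by
    continuity. This argument replaces the bounded inverse theorem. *)
Lemma compact_inverse {R : realType} {E1 E0 : hilbertType R}
    (J B : {linear E1 -> E0}) (S : {linear E0 -> E1}) :
  compact_operator J -> cancel B S -> cancel S B ->
  (forall x y, inner (J x) (B y) = inner (B x) (J y)) ->
  compact_operator (J \o S).
Proof.
move=> Jc BK SK Bsym.
have [CJ CJ0 CJP] := compact_operator_bounded Jc.
pose C (n : nat) := closure (B @` [set x | `|x| <= n%:R]).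
have [n [y0 [r [r0 rC]]]] : exists n y r, 0 < r /\ forall x, `|x| < r -> C n (y + x).
  apply: baire_ball => [n|]; first exact: closed_closure.
  apply/seteqP; split=> // y _; exists (Num.truncn `|S y|).+1 => //.
  apply: subset_closure; exists (S y) => //=; apply: ltW; exact: Num.Theory.truncnS_gt.
(* On the range of [B] this is [inner (B x) (J (S z)) = inner (J x) z]. *)
have Csym u z : C n u -> `|inner u (J (S z))| <= n%:R * CJ * `|z|.
  pose D := [set v : E0 | `|inner v (J (S z))| <= n%:R * CJ * `|z|].
  have Dcl : closed D.
    apply: (@closed_comp _ _ (fun v => `|inner v (J (S z))|)
      [set t | t <= n%:R * CJ * `|z|]); last exact: closed_le.
    by move=> v _; apply: cvg_norm; exact: inner_continuous.
  suff : C n `<=` D by move=> /(_ u).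
  rewrite (closure_id D).1//; apply: closureS => _ [x /= xn <-]; rewrite /D /=.
  rewrite -Bsym SK (le_trans (cauchy_schwarz _ _))// ler_wpM2r//.
  by rewrite (le_trans (CJP _))// mulrC ler_wpM2r// ltW.
pose M := 1 + 4 * (n%:R * CJ) / r.
have nC0 : 0 <= n%:R * CJ by rewrite mulr_ge0// ltW.
have M0 : 0 < M by rewrite ltr_pwDl// divr_ge0 ?mulr_ge0// ltW.
have TM z : `|(J \o S) z| <= M * `|z|.
  rewrite /=; have [->|t0] := eqVneq (J (S z)) 0.
    by rewrite normr0 mulr_ge0// ltW.
  have nt : 0 < `|J (S z)| by rewrite normr_gt0.
  (* Test the bound on a multiple of [J (S z)] lying in the ball of radius [r]. *)
  pose a := r / 2 / `|J (S z)|.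
  have a0 : 0 < a by rewrite !divr_gt0.
  have ar : `|a *: J (S z)| < r.
    by rewrite normrZ gtr0_norm// divfK ?gt_eqF// ltr_pdivrMr// ltr_pMr// ltr1n.
  have h1 := Csym _ z (rC _ ar).
  have h2 : `|inner y0 (J (S z))| <= n%:R * CJ * `|z|.
    by apply: Csym; rewrite -[y0]addr0; apply: rC; rewrite normr0.
  have : a * `|J (S z)| ^+ 2 <= 2 * (n%:R * CJ * `|z|).
    rewrite -inner_norm -innerZl -[a *: _](addKr y0) innerDl innerNl.
    move: h1 h2; rewrite !ler_norml; lra.
  rewrite expr2 [X in X <= _]mulrA /a divfK ?gt_eqF// -ler_pdivlMl ?divr_gt0//.
  move=> h; apply: (le_trans h).
  rewrite [X in X <= _](_ : _ = 4 * (n%:R * CJ) / r * `|z|); last first.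
    by field; rewrite gt_eqF.
  by rewrite ler_wpM2r// lerDr.
have Tcont := bounded_operator_continuous M0 TM.
pose K := closure (J @` [set x | `|x| <= n%:R]).
have cK : compact K.
  by rewrite /K -precompactE; apply: Jc; exact: (@bounded_set_norm_le _ _ _ n%:R).
have CK u : C n u -> K ((J \o S) u).
  have Dcl : closed ((J \o S) @^-1` K).
    by apply: closed_comp; [move=> v _; exact: Tcont|exact: closed_closure].
  suff : C n `<=` (J \o S) @^-1` K by move=> /(_ u).
  rewrite [X in _ `<=` X](closure_id _).1//; apply: closureS => _ [x /= xn <-].
  by rewrite BK; apply: subset_closure; exists x.
move=> D /ex_strict_bound_gt0[L L0 DL].
(* Shrinking [D] by [a] and translating it by [y0] moves it into [C n]. *)
pose a := r / L; have a0 : 0 < a by rewrite divr_gt0.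
pose g (w : E0) := a^-1 *: (w - (J \o S) y0).
apply: (@precompact_subset _ _ (g @` K)); last first.
  apply: compact_precompact; first exact: norm_hausdorff.
  apply: continuous_compact => //; apply: continuous_subspaceT => w.
  by apply: cvgZ; [exact: cvg_cst|apply: cvgB; [exact: cvg_id|exact: cvg_cst]].
move=> _ [x Dx <-]; exists ((J \o S) (y0 + a *: x)).
  apply: CK; apply: rC; rewrite normrZ gtr0_norm// /a mulrAC ltr_pdivrMr//.
  by rewrite ltr_pM2l//; exact: DL.
by rewrite /g -linearB addrAC subrr add0r linearZ scalerA mulVf ?gt_eqF// scale1r.
Qed.

(** * Making a symmetric operator of index zero invertible *)

Section finite_dimension.
Context {R : realType}.

(** Inverses and other maps obtained by choice are only known to be linear; this
    makes the theory of bundled linear maps apply to them. *)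
Lemma linear_packed (V W : lmodType R) (f : V -> W) : linear f ->
  exists g : {linear V -> W}, g =1 f.
Proof.
move=> fl; pose M := GRing.isLinear.Build R V W _ f fl.
by pose g : {linear V -> W} := HB.pack f M; exists g.
Qed.

(** The matrix of coordinates of the basis of [S] in the basis of [S'] is square
    with independent rows, hence invertible. *)
Lemma has_dim_eq (V : lmodType R) (S S' : set V) n :
  has_dim S n -> has_dim S' n -> S `<=` S' -> S' `<=` S.
Proof.
move=> [e [efree ->]] [e' [_ ->]] SS'.
have /choice[M ME] i : exists c : 'I_n -> R, e i = \sum_j c j *: e' j.
  have [|c _ <-] := SS' (e i); last by exists c.
  exists (fun j => (j == i)%:R) => //.
  rewrite (bigD1 i)//= eqxx scale1r big1 ?addr0// => j /negPf ->.
  by rewrite scale0r.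
pose P := \matrix_(i, j) M i j.
have comb (c : 'rV[R]_n) : \sum_i c 0 i *: e i = \sum_j (c *m P) 0 j *: e' j.
  under eq_bigr do rewrite ME scaler_sumr.
  rewrite exchange_big/=; apply: eq_bigr => j _; rewrite mxE scaler_suml.
  by apply: eq_bigr => i _; rewrite scalerA mxE.
have Pu : P \in unitmx.
  rewrite -row_free_unit; apply: inj_row_free => c cP.
  apply/rowP => i; rewrite mxE; apply: (efree (fun i => c 0 i)).
  by rewrite comb cP big1// => j _; rewrite mxE scale0r.
move=> _ [d _ <-]; pose c := (\row_j d j) *m invmx P.
exists (fun i => c 0 i) => //; rewrite comb mulmxKV//.
by apply: eq_bigr => j _; rewrite mxE.
Qed.

Lemma has_dim_dimension (V : lmodType R) (S : set V) :
  finite_dimensional S -> has_dim S (dimension S).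
Proof. by move=> fS; apply: xgetPex. Qed.

End finite_dimension.

Section perturbation.
Context {R : realType} {E1 E0 : hilbertType R} (J A : {linear E1 -> E0}).
Hypothesis J_inj : injective J.
Hypothesis A_sym : forall x y, inner (J x) (A y) = inner (A x) (J y).

(** The added term is symmetric for any family [v] and positive definite on the
    span of a free one. *)
Definition gram_perturbation n (v : 'I_n -> E1) (x : E1) : E0 :=
  A x + \sum_i inner (J x) (J (v i)) *: J (v i).

Lemma gram_perturbation_linear n (v : 'I_n -> E1) :
  linear (gram_perturbation v).
Proof.
move=> a x y; rewrite /gram_perturbation linearP scalerDr scaler_sumr addrACA.
congr (_ + _); rewrite -big_split/=; apply: eq_bigr => i _.
by rewrite linearP innerDl innerZl scalerDl scalerA.
Qed.

Lemma gram_perturbation_symmetric n (v : 'I_n -> E1) x y :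
  inner (J x) (gram_perturbation v y) = inner (gram_perturbation v x) (J y).
Proof.
rewrite innerDr innerDl A_sym inner_suml inner_sumr; congr (_ + _).
apply: eq_bigr => i _.
by rewrite innerZl innerZr mulrC (innerC _ (J y)).
Qed.

(** Index zero turns the inclusion of [J] of the kernel into the orthogonal
    complement of the range into an equality, so adding the Gram form of a basis
    of the kernel fills exactly the missing directions. *)
Lemma gram_perturbation_bijective :
  fredholm A -> fredholm_index A = 0 ->
  exists n (v : 'I_n -> E1), [/\ forall i, A (v i) = 0,
    forall x, gram_perturbation v x = 0 -> x = 0
    & forall y, exists x, gram_perturbation v x = y].
Proof.
move=> [fker rangeA fcoker].
have kerA := has_dim_dimension fker; have cokerA := has_dim_dimension fcoker.
rewrite /fredholm_index => /eqP; rewrite subr_eq0 eqz_nat => /eqP dimE.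
rewrite -dimE in cokerA; move: (dimension (ker A)) kerA cokerA => n.
move=> [v [vfree kerE]] cokerA; exists n, v.
have Av c : A (\sum_i c i *: v i) = 0.
  have : ker A (\sum_i c i *: v i) by rewrite kerE; exists c.
  by [].
have Avi i : A (v i) = 0.
  rewrite -(Av (fun j => (j == i)%:R)) (bigD1 i)//= eqxx scale1r big1 ?addr0//.
  by move=> j /negPf ->; rewrite scale0r.
pose u i := J (v i).
have Jc c : J (\sum_i c i *: v i) = \sum_i c i *: u i.
  by rewrite linear_sum; apply: eq_bigr => i _; rewrite linearZ.
have ufree c : \sum_i c i *: u i = 0 -> forall i, c i = 0.
  by rewrite -Jc -(linear0 J) => /J_inj/vfree.
have Au x i : inner (A x) (u i) = 0 by rewrite -A_sym Avi inner0r.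
(* The span of the [u i] lies in the complement of the range and has the same
   dimension. *)
have cokerE y : (forall x, inner (A x) y = 0) -> exists c, \sum_i c i *: u i = y.
  move=> yA; have [|||c _ <-] := @has_dim_eq _ _
      (range (fun c : 'I_n -> R => \sum_i c i *: u i)) _ n _ cokerA _ y.
  - by exists u.
  - move=> _ [c _ <-] _ [x _ <-]; rewrite inner_sumr big1// => i _.
    by rewrite innerZr Au mulr0.
  - by move=> _ [x _ <-]; exact: yA.
  by exists c.
have comb0 c : (forall j, inner (\sum_i c i *: u i) (u j) = 0) ->
    \sum_i c i *: u i = 0.
  move=> cu; apply: inner_self_eq0; rewrite inner_sumr big1// => j _.
  by rewrite innerZr cu mulr0.
split=> // [x Bx|y].
  have c0 : forall i, inner (J x) (u i) = 0.
    apply: ufree; apply: comb0 => j.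
    by rewrite -[LHS]add0r -(Au x j) -innerDl -/(gram_perturbation v x) Bx inner0l.
  have : ker A x.
    rewrite /ker /=; move: Bx; rewrite /gram_perturbation big1 ?addr0// => i _.
    by rewrite c0 scale0r.
  rewrite kerE => -[d _ dx]; apply: J_inj; rewrite linear0.
  rewrite -dx Jc; apply: comb0 => j; by rewrite -Jc dx c0.
have Mlin (a : R) w z : range A w -> range A z -> range A (a *: w + z).
  by move=> [s _ <-] [t _ <-]; exists (a *: s + t) => //; rewrite linearP.
have [_ [x0 _ <-] x0P] := projection_exists y (ex_intro _ _ (imageT A 0)) Mlin rangeA.
have [x|c cE] := cokerE (y - A x0); first by rewrite innerC x0P//; exists x.
pose G := \matrix_(i, j) inner (u i) (u j).
have GE (d : 'rV[R]_n) j :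
    (d *m G) 0 j = inner (\sum_i d 0 i *: u i) (u j).
  by rewrite mxE inner_suml; apply: eq_bigr => i _; rewrite innerZl mxE.
have Gu : G \in unitmx.
  rewrite -row_free_unit; apply: inj_row_free => d dG.
  apply/rowP => i; rewrite mxE; apply: (ufree (fun i => d 0 i)).
  by apply: comb0 => j; rewrite -GE dG mxE.
(* These coefficients correct the Gram form of [x0] to the prescribed value [c]
   without changing [A x0]. *)
pose d := (\row_j (c j - inner (J x0) (u j))) *m invmx G.
exists (x0 + \sum_i d 0 i *: v i); rewrite /gram_perturbation linearD Av addr0.
rewrite -[RHS](subrK (A x0)) addrC; congr (_ + _).
rewrite -cE; apply: eq_bigr => j _; congr (_ *: _).
by rewrite linearD innerDl Jc -GE mulmxKV// mxE addrC subrK.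
Qed.

End perturbation.

(** * The invertible operator on the scale *)

Section scale_structure.
Context {R : realType} (H : scaleHilbert R).

Lemma emb_linear k : linear (@emb R H k).
Proof.
elim: k => [//|k IH] a x y; rewrite /emb/= linearP.
exact: (IH a (Defs.incl H k x) (Defs.incl H k y)).
Qed.

Lemma emb_continuous k : continuous (@emb R H k).
Proof.
elim: k => [x|k IH x]; first exact: cvg_id.
have ci := compact_operator_continuous (incl_compact (s := H) (k := k)).
exact: (continuous_comp (ci x) (IH (Defs.incl H k x))).
Qed.

Lemma emb_linear_comb k n (c : 'I_n -> R) (w : 'I_n -> H k) x :
  emb (x + \sum_i c i *: w i) = emb x + \sum_i c i *: emb (w i).
Proof.
have [g gE] := linear_packed (@emb_linear k).
by rewrite -!gE linearD linear_sum; congr (_ + _); apply: eq_bigr => i _;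
  rewrite linearZ gE.
Qed.

Lemma shift_emb k (x : H (k + 1)%N) :
  Defs.incl H 0 (@emb R (shift_scale 1 H) k x) = @emb R H (k + 1) x.
Proof. by elim: k x => [//|k IH] x; exact: (IH (Defs.incl H (k + 1)%N x)). Qed.

(** Scale continuity from the shifted scale to [H], with the levels of the
    former read as [H k.+1]: there they are [H (k + 1)], which is not
    convertible to [H k.+1]. *)
Definition level_continuous (B : H 1 -> H 0) :=
  forall k, exists2 Bk : H k.+1 -> H k, continuous Bk &
    forall x xi, Defs.incl H 0 xi = emb x -> emb (Bk x) = B xi.

Lemma scale_continuous_level (A : {linear shift_scale 1 H 0 -> H 0}) :
  @Defs.scale_continuous R (shift_scale 1 H) H A -> level_continuous A.
Proof.
move=> Ac k.
suff : exists2 Bk : H (k + 1)%N -> H k, continuous Bk &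
    forall x xi, Defs.incl H 0 xi = emb x -> emb (Bk x) = A xi by rewrite addn1.
have [Ak AkE Akc] := Ac k; exists Ak => // x xi xiE.
by rewrite AkE; congr (A _); apply: (@incl_inj R H 0); rewrite xiE -shift_emb.
Qed.

(** Regularity makes the kernel of [A] lie in every level, so the perturbation
    restricts to a continuous map on every level and takes values in all of
    them; continuity and regularity thus pass from [A] to [B]. *)
Lemma invertible_hessian (A : {linear shift_scale 1 H 0 -> H 0}) :
  scale_hessian A -> exists B : {linear H 1 -> H 0},
  [/\ forall x, B x = 0 -> x = 0,
      forall y, exists x, B x = y,
      forall x y, inner (Defs.incl H 0 x) (B y) = inner (B x) (Defs.incl H 0 y),
      level_continuous B
    & forall n x, @level R H n (B x) -> @level R H n.+1 (Defs.incl H 0 x)].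
Proof.
move=> [/scale_continuous_level Ac As Af Ai Ar].
have [n [v [Av Binj Bsurj]]] := gram_perturbation_bijective
  (A := (A : {linear H 1 -> H 0})) (@incl_inj R H 0) As Af Ai.
have [B BE] := linear_packed (gram_perturbation_linear (Defs.incl H 0) A v).
pose u i := Defs.incl H 0 (v i).
have level0 k : @level R H k 0.
  by exists 0 => //; have [g gE] := linear_packed (@emb_linear k); rewrite -gE linear0.
have levelu k i : @level R H k (u i).
  case: k => [|k]; first by exists (u i).
  by apply: Ar; rewrite Av; exact: level0.
have levelG k x : @level R H k (B x) -> @level R H k (A x).
  move=> [z _ zB]; have /choice[w wE] i : exists w : H k, emb w = u i.
    by have [w _ wu] := levelu k i; exists w.
  exists (z + \sum_i (- inner (Defs.incl H 0 x) (u i)) *: w i) => //.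
  rewrite emb_linear_comb zB BE /gram_perturbation -addrA -big_split/= big1 ?addr0//.
  by move=> i _; rewrite wE scaleNr subrr.
exists B; split.
- by move=> x; rewrite BE; exact: Binj.
- by move=> y; have [x xy] := Bsurj y; exists x; rewrite BE.
- by move=> x y; rewrite !BE; apply: gram_perturbation_symmetric; exact: As.
- move=> k; have [Ak Akc AkE] := Ac k.
  have /choice[w wE] i : exists w : H k, emb w = u i.
    by have [w _ wu] := levelu k i; exists w.
  exists (fun x => Ak x + \sum_i inner (emb x) (u i) *: w i).
    move=> x; apply: cvgD; first exact: Akc.
    apply: cvg_big => [|i _]; first exact: add_continuous.
    apply: cvgZ; last exact: cvg_cst.
    by apply: cvg_inner; exact: emb_continuous.
  move=> x xi xiE; rewrite emb_linear_comb (AkE _ _ xiE) BE; congr (_ + _).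
  by apply: eq_bigr => i _; rewrite xiE wE.
- by move=> k x /levelG/Ar.
Qed.

End scale_structure.

(** * The levels as ranges of the powers of the inverse *)

Section iterates.
Context {R : realType} {H : scaleHilbert R}.
Variables (B : {linear H 1 -> H 0}) (T : H 0 -> H 0).
Hypothesis TB : forall xi, T (B xi) = Defs.incl H 0 xi.
Hypothesis B_surj : forall y, exists x, B x = y.

Lemma emb_succ k (x : H k.+1) : exists xi, Defs.incl H 0 xi = emb x.
Proof.
elim: k x => [x|k IH x]; first by exists x.
by have [xi xiE] := IH (Defs.incl H k.+1 x); exists xi.
Qed.

Lemma level_iter k y :
  (forall n x, @level R H n (B x) -> @level R H n.+1 (Defs.incl H 0 x)) ->
  @level R H k (iter k T y).
Proof.
move=> Breg; elim: k => [|k IH]; first by exists y.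
rewrite iterS; have [xi xiE] := B_surj (iter k T y).
by rewrite -xiE TB; apply: Breg; rewrite xiE.
Qed.

(** [D] is the [k]-fold composition of the restrictions of [B]; its continuity
    is what makes the coordinate map continuous on level [k]. *)
Lemma emb_iter k : level_continuous B ->
  exists2 D : H k -> H 0, continuous D & forall x, emb x = iter k T (D x).
Proof.
move=> Bc; elim: k => [|k [D Dc DE]]; first by exists id => // x; exact: cvg_id.
have [Bk Bkc BkE] := Bc k; exists (D \o Bk).
  by move=> x; exact: (continuous_comp (Bkc x) (Dc (Bk x))).
move=> x; have [xi xiE] := emb_succ x.
by rewrite iterS /= -DE (BkE _ _ xiE) TB.
Qed.

End iterates.

Section eigenvalue_growth.
Context {R : realType} (mu : nat -> R).
Hypothesis mu_noninc : forall n, mu n != 0 /\ `|mu n.+1| <= `|mu n|.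
Hypothesis mu_small : forall d, 0 < d -> exists n, `|mu n| < d.

Let sq_gt0 n : 0 < mu n ^+ 2.
Proof. by rewrite exprn_even_gt0//=; exact: (mu_noninc n).1. Qed.

Lemma eigenvalue_growth : exists f : growth R, forall n, f n = (mu n ^+ 2)^-1.
Proof.
have gt0 n : 0 < (mu n ^+ 2)^-1 by rewrite invr_gt0.
have nd : nondecreasing_seq (fun n => (mu n ^+ 2)^-1).
  apply/nondecreasing_seqP => n; rewrite lef_pV2 ?posrE//.
  rewrite -(real_normK (num_real (mu n))) -(real_normK (num_real (mu n.+1))).
  by rewrite ler_pXn2r ?nnegrE//; exact: (mu_noninc n).2.
have unb M : exists n, M < (mu n ^+ 2)^-1.
  have M1 : 1 <= `|M| + 1 by rewrite lerDr.
  have M0 : 0 < `|M| + 1 by rewrite (lt_le_trans ltr01).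
  have [n nM] := mu_small (d := (`|M| + 1)^-1) (ltac:(by rewrite invr_gt0)).
  exists n; apply: (@lt_le_trans _ _ (`|M| + 1)).
    by rewrite (le_lt_trans (ler_norm M))// ltrDl.
  rewrite -(invrK (`|M| + 1)) lef_pV2 ?posrE ?invr_gt0//.
  rewrite -(real_normK (num_real (mu n))) expr2 -(mulr1 (_^-1)).
  by apply: ler_pM => //; [exact: ltW|rewrite (le_trans (ltW nM))// invf_le1].
by exists (Growth gt0 nd unb).
Qed.

End eigenvalue_growth.

(** * The eigenbasis identifies the scale with a weighted sequence scale *)

(** The coordinates of [T ^ k y] are [mu n ^ k] times those of [y], so their
    [f ^ k]-weighted square sum is the square sum of the coordinates of [y]. By
    the inequality of Bessel the coordinate map sends level [k] into the weighted
    space, and by the theorem of Riesz and Fischer it is onto. *)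
Lemma fractal_of_invertible {R : realType} (H : scaleHilbert R)
    (B : {linear H 1 -> H 0}) :
  ~ finite_dimensional [set: H 0] ->
  (forall x, B x = 0 -> x = 0) ->
  (forall y, exists x, B x = y) ->
  (forall x y, inner (Defs.incl H 0 x) (B y) = inner (B x) (Defs.incl H 0 y)) ->
  level_continuous B ->
  (forall n x, @level R H n (B x) -> @level R H n.+1 (Defs.incl H 0 x)) ->
  fractal H.
Proof.
move=> Hinf Binj Bsurj Bsym Bc Breg.
have [S0 S0K] := choice Bsurj.
have BK0 x : S0 (B x) = x.
  by apply/eqP; rewrite -subr_eq0; apply/eqP/Binj; rewrite linearB S0K subrr.
have S0lin : linear S0.
  by move=> a x y; rewrite -[RHS]BK0 linearP !S0K.
have [S SE] := linear_packed S0lin.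
have SK : cancel S B by move=> y; rewrite SE.
have BK : cancel B S by move=> x; rewrite SE.
pose T : {linear H 0 -> H 0} := Defs.incl H 0 \o S.
have Tc : compact_operator T.
  exact: compact_inverse (incl_compact (s := H) (k := 0%N)) BK SK Bsym.
have Tsym x y : inner (T x) y = inner x (T y).
  by rewrite -{1}(SK y) /= Bsym SK.
have Tinj x : T x = 0 -> x = 0.
  move=> Tx; have Sx : S x = 0 by apply: (@incl_inj R H 0); rewrite linear0.
  by rewrite -(SK x) Sx linear0.
have TB xi : T (B xi) = Defs.incl H 0 xi by rewrite /= BK.
have [e [mu [eo Te mu_mono mu_small ecomplete]]] :=
  spectral_theorem Tc Tsym Tinj Hinf.
have [f fE] := eigenvalue_growth mu_mono mu_small.
have mu0 n k : mu n ^+ k != 0 by rewrite expf_neq0//; exact: (mu_mono n).1.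
have iterE k y n : inner (iter k T y) (e n) = mu n ^+ k * inner y (e n).
  elim: k => [|k IH]; first by rewrite mul1r.
  by rewrite iterS Tsym Te innerZr IH exprS mulrA.
have weightE k n (a : R) : f n ^+ k * (mu n ^+ k * a) ^+ 2 = a ^+ 2.
  by rewrite fE exprVn (exprMn _ (mu n ^+ k)) -!exprM (mulnC 2) mulrA mulVf ?mul1r.
have weight_le k y N :
    series (fun n => f n ^+ k * inner (iter k T y) (e n) ^+ 2) N <= `|y| ^+ 2.
  apply: le_trans (bessel eo y N).
  by rewrite /series/=; under eq_bigr do rewrite iterE weightE.
have phi_ex (k : nat) : exists phi : H k -> l2_level f k,
    forall x n, phi x n = inner (emb x) (e n).
  have [D _ DE] := emb_iter TB k Bc.
  suff ex (x : H k) : exists z : l2_level f k,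
      forall n, z n = inner (emb x) (e n).
    by have [phi phiE] := choice ex; exists phi.
  rewrite DE.
  have [xs _] := @square_summable_bound R (growth_weight f k) _ _ (weight_le k (D x)).
  by exists (L2 xs).
pose phi k := sval (cid (phi_ex k)).
have phiE k (x : H k) n : phi k x n = inner (emb x) (e n) by rewrite /phi; case: cid.
have phi0lin : linear (phi 0%N).
  move=> a x y; apply: val_inj; apply/funext => n.
  rewrite -[RHS]/(a * phi 0%N x n + phi 0%N y n) -[LHS]/(phi 0%N _ n) !phiE.
  by rewrite innerDl innerZl.
have [Phi PhiE] := linear_packed phi0lin.
exists f, (Phi : {linear H 0 -> l2_scale f 0}).
have Phi_n x n : (Phi x : l2_level f 0) n = inner x (e n) by rewrite PhiE phiE.
have Phi_phi k (x : H k) : @emb R (l2_scale f) k (phi k x) = Phi (emb x).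
  apply: val_inj; apply/funext => n.
  exact: etrans (l2_emb_seq _ _) (etrans (phiE _ _ _) (esym (Phi_n _ _))).
split=> [k|k].
  exists (phi k); first exact: Phi_phi.
  have [D Dc DE] := emb_iter TB k Bc.
  move=> x; apply/cvgrPdist_le => d d0.
  have /cvgrPdist_le/(_ _ d0) := Dc x; apply: filterS => z Dxz.
  apply: l2_norm_le => [|N]; first exact: ltW.
  apply: (@le_trans _ _ (`|D x - D z| ^+ 2)); last first.
    by rewrite ler_pXn2r ?nnegrE// ltW.
  apply: le_trans (bessel eo (D x - D z) N).
  rewrite le_eqVlt; apply/orP; left; apply/eqP; rewrite /series/=.
  apply: eq_bigr => n _.
  rewrite -[X in _ * X ^+ 2]/(phi k x n - phi k z n) !phiE !DE !iterE.
  rewrite -mulrBr -innerBl.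
  exact: weightE.
split=> [_ [x _ <-]|x y _ _ xy|z [w _ wz]].
- by exists (phi k x) => //; exact: Phi_phi.
- apply/eqP; rewrite -subr_eq0; apply/eqP/ecomplete => n.
  by rewrite innerBl -!Phi_n xy subrr.
have cw : cvgn (series (fun n => ((mu n ^+ k)^-1 * w n) ^+ 2)).
  rewrite (_ : (fun n => _) = fun n => f n ^+ k * w n ^+ 2).
    by have /asboolP := l2_summable w.
  by apply/funext => n; rewrite -[LHS](weightE k n) mulVKf.
have [y yE] := riesz_fischer eo cw.
exists (iter k T y); first exact: level_iter.
apply: val_inj; apply/funext => n.
have zE : (z : l2_level f 0) n = w n by rewrite -wz; exact: l2_emb_seq.
apply: etrans (Phi_n _ _) (etrans _ (esym zE)).
by rewrite iterE yE mulVKf.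
Qed.

(* Infinite dimensionality, tacit in the source, cannot be dropped: for
   H_k = R^n for all k the zero operator is a scale Hessian operator. *)
Theorem theoremA (R : realType) (H : scaleHilbert R)
    (Hinf : ~ finite_dimensional [set: H 0%N])
    (HA : exists A : {linear shift_scale 1 H 0%N -> H 0%N}, scale_hessian A) :
  fractal H.
Proof.
have [A /invertible_hessian[B [Binj Bsurj Bsym Bc Breg]]] := HA.
exact: (fractal_of_invertible (B := B)).
Qed.
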